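(* Let $(X,d)$ be a $b$-metric space (with constant $s\in[1,\infty)$), and let $(x_n)_{n\in\mathbb{N}}$ be a sequence of elements of $X$ for which there exists $\gamma\in[0,1)$ such that $d(x_{n+1},x_n)\le \gamma\, d(x_n,x_{n-1})$ for every $n\in\mathbb{N}$ with $n\ge 1$. Then $(x_n)_{n\in\mathbb{N}}$ is Cauchy.
   Context: $\mathbb{N}=\{0,1,2,\dots\}$. Given a nonempty set $X$ and a real number $s\in[1,\infty)$, a function $d:X\times X\to[0,\infty)$ is called a $b$-metric (with constant $s$) if for all $x,y,z\in X$: (i) $d(x,y)=0$ if and only if $x=y$; (ii) $d(x,y)=d(y,x)$; (iii) $d(x,y)\le s(d(x,z)+d(z,y))$. The pair $(X,d)$ is called a $b$-metric space. A sequence $(x_n)_{n\in\mathbb{N}}$ in $X$ is Cauchy if for every $\varepsilon>0$ there exists $n_\varepsilon\in\mathbb{N}$ such that $d(x_m,x_n)<\varepsilon$ for all $m,n\ge n_\varepsilon$. *)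

(* Defs.v *)
(* Stdlib reals *)
From Stdlib Require Import Reals.
Open Scope R_scope.

Record is_b_metric {X : Type} (s : R) (d : X -> X -> R) : Prop := {
  b_metric_inhabited : inhabited X;
  b_metric_const : 1 <= s;
  b_metric_nonneg : forall x y : X, 0 <= d x y;
  b_metric_eq0 : forall x y : X, d x y = 0 <-> x = y;
  b_metric_sym : forall x y : X, d x y = d y x;
  b_metric_triangle : forall x y z : X, d x y <= s * (d x z + d z y)
}.

(* The Stdlib notion [Cauchy_crit] only covers real sequences, and a b-metric
   need not satisfy the triangle inequality of [Metric_Space]. *)
Definition is_cauchy {X : Type} (d : X -> X -> R) (x : nat -> X) : Prop :=
  forall eps : R, 0 < eps ->
    exists N : nat, forall m n : nat,
      (N <= m)%nat -> (N <= n)%nat -> d (x m) (x n) < eps.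

(* Main.v *)
Require Import Defs.
From Stdlib Require Import Reals.
From Stdlib Require Import Lra Lia Wf_nat.
Open Scope R_scope.

(** Consecutive distances decay like [gamma ^ n], but summing them with the
    relaxed triangle inequality costs a factor [s] per term, so the usual
    geometric series argument only works when [s * gamma < 1].  The remedy is
    to move in blocks of a fixed length [k] with [s * gamma ^ k <= 1/2].
    Within one block the cost of chaining is a constant [B]
    ([geometric_steps_bounded_range]).  A bound
    [d (x n) (x (n + m)) <= C * gamma ^ n] then propagates from [m - k] to [m]:
    jumping over one block gives [s * (B + C * gamma ^ k) <= s * B + C / 2],
    which is at most [C] for [C = 2 * s * B] ([geometric_steps_uniform]).
    Since [C] does not depend on [m], the sequence is Cauchy. *)

Lemma contraction_steps_geometric (u : nat -> R) (gamma : R) :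
  0 <= gamma ->
  (forall n, u (S n) <= gamma * u n) ->
  forall n, u n <= u 0%nat * gamma ^ n.
Proof.
  intros Hg Hu n; induction n as [|n IH]; simpl; [lra|].
  specialize (Hu n); nra.
Qed.

Lemma pow_antitone_exponent (gamma : R) (m n : nat) :
  0 <= gamma <= 1 -> (m <= n)%nat -> gamma ^ n <= gamma ^ m.
Proof.
  intros Hg Hmn; induction Hmn as [|n Hmn IH]; simpl; [lra|].
  pose proof (pow_le gamma n (proj1 Hg)); nra.
Qed.

(** Each extra step costs one factor [s], so [B] grows with [k]; in exchange,
    no smallness of [s * gamma] is required. *)
Lemma geometric_steps_bounded_range {X : Type} (s : R) (d : X -> X -> R)
  (x : nat -> X) (D gamma : R) :
  is_b_metric s d -> 0 <= gamma <= 1 -> 0 <= D ->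
  (forall n, d (x n) (x (S n)) <= D * gamma ^ n) ->
  forall k, exists B, 0 <= B /\
    forall m n, (m <= k)%nat -> d (x n) (x (n + m)%nat) <= B * gamma ^ n.
Proof.
  intros hd Hg HD Hstep k.
  pose proof (b_metric_const _ _ hd) as Hs.
  assert (Hzero : forall n, d (x n) (x (n + 0)%nat) = 0)
    by (intro n; apply (b_metric_eq0 _ _ hd); f_equal; lia).
  induction k as [|k [B [HB IH]]].
  - exists 0; split; [lra|]; intros m n Hm.
    replace m with 0%nat by lia; rewrite Hzero; lra.
  - exists (s * (D + B)); split; [nra|].
    intros [|m] n Hm; pose proof (pow_le gamma n (proj1 Hg)) as Hp.
    + rewrite Hzero; apply Rmult_le_pos; [nra|exact Hp].
    + pose proof (b_metric_triangle _ _ hd (x n) (x (n + S m)%nat) (x (S n)))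
        as Htri.
      specialize (Hstep n).
      specialize (IH m (S n) ltac:(lia)).
      replace (S n + m)%nat with (n + S m)%nat in IH by lia.
      pose proof (pow_antitone_exponent gamma n (S n) Hg ltac:(lia)) as Hdec.
      assert (B * gamma ^ S n <= B * gamma ^ n)
        by (apply Rmult_le_compat_l; assumption).
      eapply Rle_trans; [exact Htri|].
      rewrite Rmult_assoc; apply Rmult_le_compat_l; lra.
Qed.

(** Strong induction on [m], descending by whole blocks of length [k]: over a
    block the gain [gamma ^ k] absorbs the factor [s] of the triangle inequality,
    which the gain [gamma] over a single step need not do. *)
Lemma geometric_steps_uniform {X : Type} (s : R) (d : X -> X -> R)
  (x : nat -> X) (D gamma : R) :
  is_b_metric s d -> 0 <= gamma < 1 -> 0 <= D ->
  (forall n, d (x n) (x (S n)) <= D * gamma ^ n) ->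
  exists C, 0 <= C /\ forall m n, d (x n) (x (n + m)%nat) <= C * gamma ^ n.
Proof.
  intros hd Hg HD Hstep.
  pose proof (b_metric_const _ _ hd) as Hs.
  assert (Hk : exists k, (1 <= k)%nat /\ s * gamma ^ k <= / 2).
  { destruct (pow_lt_1_zero gamma) with (y := / (2 * s)) as [k Hk].
    - rewrite Rabs_pos_eq; lra.
    - apply Rinv_0_lt_compat; lra.
    - exists (S k); split; [lia|].
      specialize (Hk (S k) ltac:(lia)).
      rewrite Rabs_pos_eq in Hk by (apply pow_le; lra).
      apply Rmult_lt_compat_l with (r := s) in Hk; [|lra].
      replace (s * / (2 * s)) with (/ 2) in Hk by (field; lra); lra. }
  destruct Hk as [k [Hk1 Hk]].
  destruct (geometric_steps_bounded_range s d x D gamma hd ltac:(lra) HD Hstep k)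
    as [B [HB Hblock]].
  exists (2 * s * B); split; [nra|].
  intro m; induction m as [m IH] using (well_founded_induction lt_wf); intro n.
  pose proof (pow_le gamma n (proj1 Hg)) as Hp.
  destruct (Nat.le_gt_cases m k) as [Hmk|Hmk].
  - eapply Rle_trans; [apply Hblock, Hmk|].
    apply Rmult_le_compat_r; [exact Hp|nra].
  - specialize (IH (m - k)%nat ltac:(lia) (n + k)%nat).
    replace (n + k + (m - k))%nat with (n + m)%nat in IH by lia.
    specialize (Hblock k n (le_n k)).
    rewrite pow_add in IH.
    pose proof (b_metric_triangle _ _ hd (x n) (x (n + m)%nat) (x (n + k)%nat))
      as Htri.
    eapply Rle_trans; [exact Htri|].
    apply Rle_trans with
      (s * (B * gamma ^ n + 2 * s * B * (gamma ^ n * gamma ^ k))).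
    + apply Rmult_le_compat_l; lra.
    + assert (Hpos : 0 <= s * B * gamma ^ n)
        by (apply Rmult_le_pos; [nra|exact Hp]).
      pose proof (Rmult_le_compat_l _ _ _ Hpos Hk); lra.
Qed.

Lemma geometric_tails_cauchy {X : Type} (d : X -> X -> R) (x : nat -> X)
  (C gamma : R) :
  (forall a b, d a b = d b a) -> 0 <= gamma < 1 -> 0 <= C ->
  (forall m n, d (x n) (x (n + m)%nat) <= C * gamma ^ n) ->
  is_cauchy d x.
Proof.
  intros Hsym Hg HC Htail eps Heps.
  (* Dividing by [C + 1] rather than [C] covers the case [C = 0]. *)
  assert (Heps' : 0 < eps / (C + 1)) by (apply Rdiv_lt_0_compat; lra).
  destruct (pow_lt_1_zero gamma) with (y := eps / (C + 1)) as [N HN];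
    [rewrite Rabs_pos_eq; lra | exact Heps' |].
  specialize (HN N (le_n N)).
  rewrite Rabs_pos_eq in HN by (apply pow_le; lra).
  assert (HCN : C * gamma ^ N < eps).
  { apply Rmult_lt_compat_l with (r := C + 1) in HN; [|lra].
    replace ((C + 1) * (eps / (C + 1))) with eps in HN by (field; lra).
    pose proof (pow_le gamma N (proj1 Hg)); lra. }
  assert (Hord : forall m n, (N <= m <= n)%nat -> d (x m) (x n) < eps).
  { intros m n Hmn.
    specialize (Htail (n - m)%nat m).
    replace (m + (n - m))%nat with n in Htail by lia.
    pose proof (pow_antitone_exponent gamma N m ltac:(lra) ltac:(lia)) as Hdec.
    apply Rmult_le_compat_l with (r := C) in Hdec; lra. }
  exists N; intros m n Hm Hn.
  destruct (Nat.le_ge_cases m n) as [H|H].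
  - apply Hord; lia.
  - rewrite Hsym; apply Hord; lia.
Qed.

Theorem lemma2p2 (X : Type) (s : R) (d : X -> X -> R) (hd : is_b_metric s d)
  (x : nat -> X)
  (hx : exists gamma : R, 0 <= gamma < 1 /\
    forall n : nat, (1 <= n)%nat ->
      d (x (n + 1)%nat) (x n) <= gamma * d (x n) (x (n - 1)%nat)) :
  is_cauchy d x.
Proof.
  destruct hx as [gamma [Hg Hcontr]].
  pose proof (b_metric_sym _ _ hd) as Hsym.
  assert (Hstep : forall n,
    d (x n) (x (S n)) <= d (x 0%nat) (x 1%nat) * gamma ^ n).
  { apply (contraction_steps_geometric (fun n => d (x n) (x (S n))));
      [lra|intro n].
    specialize (Hcontr (S n) ltac:(lia)).
    replace (S n + 1)%nat with (S (S n)) in Hcontr by lia.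
    replace (S n - 1)%nat with n in Hcontr by lia.
    rewrite (Hsym (x (S (S n)))), (Hsym (x (S n)) (x n)) in Hcontr.
    exact Hcontr. }
  destruct (geometric_steps_uniform s d x _ gamma hd Hg
              (b_metric_nonneg _ _ hd _ _) Hstep) as [C [HC Htail]].
  exact (geometric_tails_cauchy d x C gamma Hsym Hg HC Htail).
Qed.
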